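(* Let $X$ and $Y$ be real normed spaces with $X\neq\{0\}$, and let $f: X \rightarrow Y$ be a phase-isometry (not necessarily surjective). Then for every $w^*$-exposed point $x^*$ of the closed unit ball $B_{X^*}$ of the dual space $X^*$, there exists a linear functional $\varphi \in Y^*$ of norm one such that for every $x\in X$ one has $x^*(x)=\varphi(f(x))$ or $x^*(x)=-\varphi(f(x))$ (the sign may depend on $x$).
   Context: A mapping $f: X\to Y$ between real normed spaces is a phase-isometry if $\{\|f(x)+f(y)\|, \|f(x)-f(y)\|\}=\{\|x+y\|, \|x-y\|\}$ (equality of unordered pairs) for all $x,y\in X$. No continuity or linearity is assumed. A point $x^*$ of a $w^*$-closed convex set $C\subset X^*$ is a $w^*$-exposed point of $C$ if there exists $x\in X$ such that $x^*(x)>y^*(x)$ for all $y^*\in C$ with $y^*\neq x^*$. *)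

(* Defs.v *)
From mathcomp Require Import all_boot all_order all_algebra.
From mathcomp Require Import all_classical all_reals all_analysis.
Import Order.TTheory GRing.Theory Num.Theory.
Import numFieldNormedType.Exports.

Set Implicit Arguments.
Unset Strict Implicit.
Unset Printing Implicit Defensive.

Local Open Scope classical_set_scope.
Local Open Scope ring_scope.

(* Two-element sets are equal iff the corresponding unordered pairs (with
   multiplicity) are. *)
Definition phase_isometry (R : realType) (X Y : normedModType R)
    (f : X -> Y) : Prop :=
  forall x y : X,
    [set `|f x + f y|; `|f x - f y|] = [set `|x + y|; `|x - y|].

Definition dual_space (R : realType) (X : normedModType R) : set {linear X -> R^o} :=
  [set phi : {linear X -> R^o} | continuous phi].

(* Only meaningful on [dual_space]: [sup] of an unbounded set is 0 by convention. *)
Definition dual_norm (R : realType) (X : normedModType R)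
    (phi : {linear X -> R^o}) : R :=
  sup [set `|phi x| | x in [set x : X | `|x| <= 1]].

Definition dual_unit_ball (R : realType) (X : normedModType R) :
    set {linear X -> R^o} :=
  [set phi : {linear X -> R^o} | dual_space phi /\ dual_norm phi <= 1].

(* The exposing functional is evaluation at a point of [X], which is what makes
   this weak-star exposedness.  Functionals are compared as functions. *)
Definition wstar_exposed (R : realType) (X : normedModType R)
    (C : set {linear X -> R^o}) (phi : {linear X -> R^o}) : Prop :=
  C phi /\
  exists x : X, forall psi : {linear X -> R^o},
    C psi -> (psi : X -> R^o) <> phi -> psi x < phi x.

(* Main.v *)
(** A functional exposed by [u] is the only norm-one functional supporting the
    ball at [u], so Hahn-Banach forces |t u + x| - t |u| to decrease to
    xstar x as t grows.  Let phi_n be a norming functional of f (n u).  The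
    phase-isometry identity for the pair (n u, x) squeezes
    |phi_n (f x)| towards |xstar x|, and the limit of the phi_n along an
    ultrafilter is the required functional. *)
From HB Require Import structures.
Require Import Defs.
From mathcomp Require Import all_boot all_order all_algebra.
From mathcomp Require Import all_classical all_reals all_analysis.
From mathcomp Require Import ring lra.
Import Order.TTheory GRing.Theory Num.Theory.
Import numFieldNormedType.Exports.

Set Implicit Arguments.
Unset Strict Implicit.

Local Open Scope classical_set_scope.
Local Open Scope ring_scope.

(** One-sided homogeneity is enough: applied to [t^-1] it yields the reverse inequality. *)
Definition sublinear (R : realType) (V : lmodType R) (p : V -> R) : Prop :=
  (forall x y, p (x + y) <= p x + p y) /\
  (forall t x, 0 < t -> p (t *: x) <= t * p x).

(** * Hahn-Banach through minimal sublinear functionals *)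

Section Sublinear.
Variables (R : realType) (V : lmodType R).
Implicit Types (p q : V -> R) (x y : V).

Lemma sublinear0 p : sublinear p -> p 0 = 0.
Proof.
move=> [pD pZ].
have := pD 0 0; rewrite addr0 => h1.
have := pZ (1/2) 0 ltac:(lra); rewrite scaler0 => h2.
lra.
Qed.

Lemma sublinearZ p t x : sublinear p -> 0 <= t -> p (t *: x) = t * p x.
Proof.
move=> sp; rewrite le_eqVlt => /orP[/eqP <-|t0].
  by rewrite scale0r mul0r sublinear0.
apply/eqP; rewrite eq_le sp.2 //=.
have := sp.2 t^-1 (t *: x); rewrite invr_gt0 => /(_ t0).
by rewrite scalerA mulVf ?gt_eqF // scale1r mulrC ler_pdivlMr // mulrC.
Qed.

Lemma sublinear_geN p x : sublinear p -> - p (- x) <= p x.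
Proof.
move=> sp; have := sp.1 x (- x); rewrite subrr sublinear0 //; lra.
Qed.

Lemma sublinear_norm (W : normedModType R) :
  sublinear (fun x : W => `|x|).
Proof.
split=> [x y|t x t0]; first exact: ler_normD.
by rewrite normrZ gtr0_norm.
Qed.

(** Serves both [tilt] and the chains of Zorn's lemma. The minorant [b] keeps every infimum genuine,
    since [inf] of a set unbounded below is 0 by convention. *)
Lemma inf_sublinear (F : set (V -> R)) (b : V -> R) :
  F !=set0 -> (forall q, F q -> forall x, b x <= q x) ->
  (forall q1 q2 x y, F q1 -> F q2 ->
     exists2 q, F q & q (x + y) <= q1 x + q2 y) ->
  (forall q t x, F q -> 0 < t -> exists2 q', F q' & q' (t *: x) <= t * q x) ->
  sublinear (fun x => inf [set q x | q in F]).
Proof.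
move=> [q0 Fq0] bF FD FZ.
have lbF x : has_lbound [set q x | q in F].
  by exists (b x) => _ [q Fq <-]; exact: bF.
have infle q x : F q -> inf [set q x | q in F] <= q x.
  by move=> Fq; apply: ge_inf => //; exists q.
have leinf c x : (forall q, F q -> c <= q x) -> c <= inf [set q x | q in F].
  move=> h; apply: lb_le_inf; first by exists (q0 x), q0.
  by move=> _ [q Fq <-]; exact: h.
split=> [x y|t x t0].
  rewrite -lerBlDr; apply: (leinf) => q1 Fq1.
  rewrite lerBlDr -lerBlDl; apply: (leinf) => q2 Fq2; rewrite lerBlDl.
  have [q Fq] := FD q1 q2 x y Fq1 Fq2.
  exact: le_trans (infle _ _ Fq).
rewrite mulrC -ler_pdivrMr //; apply: (leinf) => q Fq.
rewrite ler_pdivrMr // mulrC.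
have [q' Fq'] := FZ q t x Fq t0.
exact: le_trans (infle _ _ Fq').
Qed.

(* The one-sided directional derivative of [p] at [x], with step [1/t]. *)
Definition tilt p x y : R :=
  inf [set q y | q in [set (fun y => p (y + t *: x) - t * p x) | t in
                        [set t : R | 0 <= t]]].

Lemma tilt_lbound p x t y : sublinear p -> 0 <= t ->
  - p (- y) <= p (y + t *: x) - t * p x.
Proof.
move=> sp t0; rewrite -(sublinearZ _ sp t0).
have := sp.1 (y + t *: x) (- y); rewrite addrAC subrr add0r; lra.
Qed.

Lemma tilt_le p x t y : sublinear p -> 0 <= t ->
  tilt p x y <= p (y + t *: x) - t * p x.
Proof.
move=> sp t0; apply: ge_inf.
  exists (- p (- y)) => _ [_ [s /= s0 <-] <-]; exact: tilt_lbound.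
by exists (fun y => p (y + t *: x) - t * p x) => //; exists t.
Qed.

Lemma tilt_le_self p x y : sublinear p -> tilt p x y <= p y.
Proof.
move=> sp; have := tilt_le x y sp (lexx 0).
by rewrite scale0r addr0 mul0r subr0.
Qed.

(** Take the step [t = 1]. A linear functional below the tilt is thereby forced to be at least [p x]
    at [x]. *)
Lemma tiltN p x : sublinear p -> tilt p x (- x) <= - p x.
Proof.
move=> sp; have := tilt_le x (- x) sp ler01.
by rewrite scale1r addNr sublinear0 // mul1r sub0r.
Qed.

Lemma tilt_sublinear p x : sublinear p -> sublinear (tilt p x).
Proof.
move=> sp; apply: (@inf_sublinear _ (fun y => - p (- y))).
- by exists (fun y => p (y + 0 *: x) - 0 * p x); exists 0 => //=.
- by move=> _ [t /= t0 <-] y; exact: tilt_lbound.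
- move=> _ _ y z [t /= t0 <-] [s /= s0 <-].
  exists (fun y => p (y + (t + s) *: x) - (t + s) * p x).
    by exists (t + s) => //=; exact: addr_ge0.
  have := sp.1 (y + t *: x) (z + s *: x).
  rewrite addrACA -scalerDl /=; lra.
- move=> _ s y [t /= t0 <-] s0.
  exists (fun y => p (y + (s * t) *: x) - (s * t) * p x).
    by exists (s * t) => //=; rewrite mulr_ge0 // ltW.
  by rewrite /= -scalerA -scalerDr (sublinearZ _ sp (ltW s0)) mulrBr mulrA.
Qed.

(** By subadditivity [p (y + t *: x) - t * p x] is nonincreasing in [t], so a near-minimal step [t0]
    controls all larger ones. *)
Lemma tilt_near p x y e : sublinear p -> 0 < e ->
  exists2 t0, 0 <= t0 &
    forall t, t0 <= t -> p (y + t *: x) - t * p x <= tilt p x y + e.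
Proof.
move=> sp e0.
have [|_ [_ [t0 /= t00 <-] <-] lt0] := inf_adherent e0
    (E := [set q y | q in [set (fun y => p (y + t *: x) - t * p x) | t in
                        [set t : R | 0 <= t]]]).
  split; first by exists (p (y + 0 *: x) - 0 * p x);
    exists (fun y => p (y + 0 *: x) - 0 * p x) => //; exists 0 => //=.
  exists (- p (- y)) => _ [_ [s /= s0 <-] <-]; exact: tilt_lbound.
exists t0 => // t t0t; apply: le_trans (ltW lt0).
have := sp.1 (y + t0 *: x) ((t - t0) *: x).
rewrite -addrA -scalerDl (addrC t0) subrK (sublinearZ (t := t - t0)) ?subr_ge0 //.
lra.
Qed.

(** Zorn's lemma for the reversed pointwise order; a nonempty chain is bounded by its pointwise
    infimum, finite because a sublinear [q] below [p] satisfies [- p (- x) <= - q (- x) <= q x]. *)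
Lemma exists_minimal_sublinear p : sublinear p ->
  exists q, [/\ sublinear q, forall x, q x <= p x &
    forall q', sublinear q' -> (forall x, q' x <= q x) ->
      forall x, q x <= q' x].
Proof.
move=> sp.
pose T := {q : V -> R | sublinear q /\ forall x, q x <= p x}.
pose r (q1 q2 : T) := `[< forall x, sval q2 x <= sval q1 x >].
have [| | |[q [sq qp]] qmax] := @ZL_preorder T
    (exist _ p (conj sp (fun x => lexx (p x)))) r.
- by move=> q; apply/asboolP => x.
- move=> q2 q1 q3 /asboolP h1 /asboolP h2; apply/asboolP => x.
  exact: le_trans (h2 x) (h1 x).
- move=> A totA.
  have [[q0 Aq0]|A0] := pselect (A !=set0); last first.
    exists (exist _ p (conj sp (fun x => lexx (p x)))) => s As.
    by exfalso; apply: A0; exists s.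
  have lbA (q : T) x : A q -> - p (- x) <= sval q x.
    move=> _; apply: le_trans (sublinear_geN x (svalP q).1).
    by rewrite lerN2; exact: (svalP q).2.
  have sinf : sublinear (fun x => inf [set q x | q in sval @` A]).
    apply: (@inf_sublinear _ (fun x => - p (- x))).
    + by exists (sval q0), q0.
    + by move=> _ [q Aq <-] x; exact: lbA.
    + move=> _ _ x y [q1 Aq1 <-] [q2 Aq2 <-].
      have [/asboolP h|/asboolP h] := totA _ _ Aq1 Aq2.
      * exists (sval q2); first by exists q2.
        by apply: le_trans ((svalP q2).1.1 x y) _; rewrite lerD2r.
      * exists (sval q1); first by exists q1.
        by apply: le_trans ((svalP q1).1.1 x y) _; rewrite lerD2l.
    + move=> _ t x [q Aq <-] t0; exists (sval q); first by exists q.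
      exact: (svalP q).1.2.
  have infle (q : T) x : A q -> inf [set q x | q in sval @` A] <= sval q x.
    move=> Aq; apply: ge_inf; last by exists (sval q) => //; exists q.
    by exists (- p (- x)) => _ [_ [q' Aq' <-] <-]; exact: lbA.
  have infp x : inf [set q x | q in sval @` A] <= p x.
    exact: le_trans (infle _ _ Aq0) ((svalP q0).2 x).
  exists (exist _ (fun x => inf [set q x | q in sval @` A]) (conj sinf infp)) => q Aq.
  by apply/asboolP => x; exact: infle.
- exists q; split=> // q' sq' q'q.
  have q'p x : q' x <= p x by exact: le_trans (q'q x) (qp x).
  have := qmax (exist _ q' (conj sq' q'p)).
  by move=> /(_ (introT (asboolP _) q'q))/asboolP.
Qed.

(** By minimality [q] lies below its own tilt at [x]; the step 1 then gives
    [q y <= q (y + x) - q x], the converse of subadditivity. *)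
Lemma minimal_sublinear_linear q : sublinear q ->
  (forall q', sublinear q' -> (forall x, q' x <= q x) ->
      forall x, q x <= q' x) ->
  linear (q : V -> R^o).
Proof.
move=> sq qmin.
have qD x y : q (x + y) = q x + q y.
  apply/eqP; rewrite eq_le sq.1 /=.
  have h := qmin _ (tilt_sublinear x sq) (fun z => tilt_le_self x z sq) y.
  have := tilt_le x y sq ler01; rewrite scale1r mul1r addrC.
  rewrite (addrC y); lra.
have qN x : q (- x) = - q x.
  by have := qD x (- x); rewrite subrr sublinear0 //; lra.
have qZ t x : q (t *: x) = t * q x.
  have [t0|t0] := leP 0 t; first exact: sublinearZ.
  rewrite -[t]opprK scaleNr qN sublinearZ ?oppr_ge0 ?ltW //; ring.
by move=> t x y; rewrite qD qZ.
Qed.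

(** Minimising below [tilt p x] rather than below [p] builds in attainment at [x], through
    [tiltN]. *)
Lemma hahn_banach_point p x : sublinear p ->
  exists phi : {linear V -> R^o}, (forall y, phi y <= p y) /\ phi x = p x.
Proof.
move=> sp.
have [q [sq qt qmin]] := exists_minimal_sublinear (tilt_sublinear x sp).
have lq := minimal_sublinear_linear sq qmin.
pose phi : {linear V -> R^o} :=
  HB.pack (q : V -> R^o) (GRing.isLinear.Build _ _ _ _ _ lq).
have phip y : phi y <= p y by exact: le_trans (qt y) (tilt_le_self x y sp).
exists phi; split=> //; apply/eqP; rewrite eq_le phip /=.
have : phi (- x) <= - p x by exact: le_trans (qt _) (tiltN x sp).
by rewrite linearN lerN2.
Qed.

End Sublinear.

(** * The dual unit ball and its weak-star exposed points *)

Section DualBall.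
Variables (R : realType) (X : normedModType R).
Implicit Types (phi : {linear X -> R^o}).

Lemma linear_le_norm_abs phi :
  (forall x, phi x <= `|x|) -> forall x, `|phi x| <= `|x|.
Proof.
move=> h x; rewrite ler_norml h andbT lerNl.
have : phi (- x) <= `|- x| := h _.
by rewrite linearN normrN.
Qed.

Lemma linear_le_norm_dual phi :
  (forall x, phi x <= `|x|) -> dual_space phi.
Proof.
move=> h; apply/bounded_linear_continuous/linear_boundedP.
near=> r => x; apply: le_trans (linear_le_norm_abs h x) _.
by rewrite ler_peMl //; near: r; exact: nbhs_pinfty_ge.
Unshelve. all: by end_near. Qed.

(** From left to right, continuity bounds the set whose [sup] is the dual norm, so that this [sup]
    is a true upper bound; a nonzero [x] is then rescaled to norm 1. *)
Lemma dual_unit_ballP phi :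
  dual_unit_ball phi <-> forall x, phi x <= `|x|.
Proof.
split=> [[cphi nphi] x|h]; last first.
  split; first exact: linear_le_norm_dual.
  apply: ge_sup; first by exists `|phi 0|, 0; rewrite //= normr0.
  by move=> _ [x /= x1 <-]; exact: le_trans (linear_le_norm_abs h x) x1.
have [->|x0] := eqVneq x 0; first by rewrite linear0 normr0.
have nx : 0 < `|x| by rewrite normr_gt0.
have ubphi : has_ubound [set `|phi x| | x in [set x : X | `|x| <= 1]].
  have /linear_boundedP/pinfty_ex_gt0[M M0 hM] :=
    continuous_linear_bounded 0 (cphi 0).
  exists M => _ [y /= y1 <-]; apply: le_trans (hM y) _.
  by rewrite ger_pMr.
have : `|phi (`|x|^-1 *: x)| <= 1.
  apply: le_trans nphi; apply: ub_le_sup => //.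
  exists (`|x|^-1 *: x) => //=.
  by rewrite normrZ gtr0_norm ?invr_gt0 // mulVf ?gt_eqF.
rewrite linearZ /= normrZ gtr0_norm ?invr_gt0 // mulrC ler_pdivrMr // mul1r.
exact: le_trans (ler_norm _).
Qed.

Lemma dual_norm_eq1 phi x : (forall y, phi y <= `|y|) -> x != 0 ->
  `|phi x| = `|x| -> dual_norm phi = 1.
Proof.
move=> h x0 phix; apply/eqP; rewrite eq_le.
rewrite (proj2 ((dual_unit_ballP phi).2 h)) /=.
have nx : `|x| != 0 by rewrite normr_eq0.
apply: ub_le_sup.
  by exists 1 => _ [y /= y1 <-]; exact: le_trans (linear_le_norm_abs h y) y1.
exists (`|x|^-1 *: x) => /=; first by rewrite normrZ normfV normr_id mulVf.
by rewrite linearZ /= normrZ normfV normr_id phix mulVf.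
Qed.

(** For each [y], Hahn-Banach gives [psi] below the tilt at [u] and equal to it at [y]. Then [psi]
    is in the ball and [psi u >= phi u], so exposedness forces [psi = phi]. *)
Lemma wstar_exposed_tilt phi : wstar_exposed (@dual_unit_ball R X) phi ->
  exists u, forall y, phi y = tilt (fun x => `|x|) u y.
Proof.
move=> [/dual_unit_ballP Bphi [u hu]]; exists u => y.
have sn := sublinear_norm X.
have [psi [psit psiy]] := hahn_banach_point y (tilt_sublinear u sn).
have psin z : psi z <= `|z| by exact: le_trans (psit z) (tilt_le_self u z sn).
have psiu : `|u| <= psi u.
  have : psi (- u) <= - `|u| by exact: le_trans (psit _) (tiltN u sn).
  by rewrite linearN lerN2.
have [<-|/hu] := pselect ((psi : X -> R^o) = phi); first exact: psiy.
move=> /(_ ((dual_unit_ballP psi).2 psin)) lt.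
by have := lt_le_trans lt (le_trans (Bphi u) psiu); rewrite ltxx.
Qed.

End DualBall.

(** Stands in for weak-star compactness: a single ultrafilter makes all evaluations of a bounded
    sequence of functionals converge. Compactness gives a cluster point, and an ultrafilter
    converges to its cluster points. *)
Lemma ultra_bounded_cvg (R : realType) (I : Type) (U : set_system I)
    (a : I -> R) (M : R) : UltraFilter U -> (forall i, `|a i| <= M) ->
  cvg (a @ U).
Proof.
move=> UU aM.
have [c [_ clc]] : `[- M, M]%classic `&` cluster (a @ U) !=set0.
  apply: (segment_compact (R := R)).
  apply: (@filterE _ U) => i; rewrite /= in_itv /=.
  by rewrite -ler_norml.
apply/cvg_ex; exists c => W Wc.
have [//|UW] := in_ultra_setVsetC (a @^-1` W) UU.
by have [z [nWz Wz]] := clc (~` W) W UW Wc.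
Qed.

Unset Implicit Arguments.

(** * Norming functionals along the ray of [u] and their limit *)

Theorem lemma2p6 (R : realType) (X Y : normedModType R)
    (X_nontrivial : [set: X] <> [set 0])
    (f : X -> Y) (f_phase : phase_isometry f)
    (xstar : {linear X -> R^o})
    (xstar_exposed : wstar_exposed (@dual_unit_ball R X) xstar) :
  exists phi : {linear Y -> R^o},
    [/\ dual_space phi, dual_norm phi = 1 &
        forall x : X, xstar x = phi (f x) \/ xstar x = - phi (f x)].
Proof.
have Bx : forall x, xstar x <= `|x| by apply/dual_unit_ballP; exact: xstar_exposed.1.
have sn := sublinear_norm X.
have [u xu] := wstar_exposed_tilt xstar_exposed.
have xuu : xstar u = `|u|.
  apply/eqP; rewrite eq_le Bx /= -lerN2 -linearN xu; exact: tiltN.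
have u0 : u != 0.
  apply/eqP => u0; apply: X_nontrivial; apply/seteqP; split=> // x _ /=.
  (* if [u = 0], the tilt at [u] is the norm, which is linear only on [0] *)
  have xnorm y : xstar y = `|y|.
    apply/eqP; rewrite eq_le Bx /= xu.
    apply: lb_le_inf.
      exists (`|y + 0 *: u| - 0 * `|u|).
      by exists (fun y => `|y + 0 *: u| - 0 * `|u|) => //; exists 0 => //=.
    by move=> _ [_ [t /= _ <-] <-]; rewrite u0 scaler0 addr0 normr0 mulr0 subr0.
  have := xnorm (- x); rewrite linearN xnorm normrN => h.
  have : `|x| = 0 by move: h (normr_ge0 x); lra.
  by move/eqP; rewrite normr_eq0 => /eqP.
(* For the pair [(x, x)] the two sets are {2|f x|, 0} and {2|x|, 0}. *)
have fnorm x : `|f x| = `|x|.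
  have : [set `|f x + f x|; `|f x - f x|] `|x + x| by rewrite f_phase; left.
  have : [set `|x + x|; `|x - x|] `|f x + f x| by rewrite -f_phase; left.
  rewrite /= !subrr !normr0 -!mulr2n !normrMn => h1 h2.
  by move: h1 h2; rewrite !mulr2n; case=> ?; case=> ?; lra.
have /choice [phin hphin] : forall n : nat, exists phi : {linear Y -> R^o},
    (forall y, phi y <= `|y|) /\ phi (f (n%:R *: u)) = `|f (n%:R *: u)|.
  by move=> n; apply: hahn_banach_point; exact: sublinear_norm.
have phinN n y : `|phin n y| <= `|y|.
  by apply: linear_le_norm_abs; exact: (hphin n).1.
(* [U] refines the filter at infinity, so ordinary limits in [n] persist along it. *)
have [U [UU ooU]] := @ultraFilterLemma nat \oo _.
have cphi y : cvg (phin n y @[n --> U]) by exact: ultra_bounded_cvg.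
pose phi0 (y : Y) : R^o := lim (phin n y @[n --> U]).
have lphi : linear phi0.
  move=> t y z; apply/cvg_lim => //.
  under eq_fun do rewrite linearP.
  by apply: cvgD; [apply: cvgZr|]; exact: cphi.
pose phi : {linear Y -> R^o} :=
  HB.pack phi0 (GRing.isLinear.Build _ _ _ _ _ lphi).
have phile y : phi y <= `|y|.
  apply: limr_le; first exact: cphi.
  by apply: filterE => n; exact: (hphin n).1.
(* The sign relating [phin n (f x)] to [xstar x] may change with [n]; only absolute values are
   passed to the limit. *)
have phif x : `|phi (f x)| = `|xstar x|.
  have h1 : `|phin n (f x)| @[n --> U] --> `|phi (f x)|.
    by apply: cvg_norm; exact: cphi.
  apply: (cvg_unique _ h1) => //.
  apply: cvg_trans (_ : `|phin n (f x)| @[n --> \oo] --> `|xstar x|).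
    by move=> A; exact: ooU.
  apply/cvgrPdist_le => e e0.
  have [t1 t10 ht1] := tilt_near u x sn e0.
  have [t2 t20 ht2] := tilt_near u (- x) sn e0.
  near=> n.
  have {}ht1 : `|x + n%:R *: u| - n%:R * `|u| <= xstar x + e.
    by rewrite xu; apply: ht1; near: n; exact: nbhs_infty_ger.
  have {}ht2 : `|- x + n%:R *: u| - n%:R * `|u| <= - xstar x + e.
    by rewrite -linearN xu; apply: ht2; near: n; exact: nbhs_infty_ger.
  have [_ hn] := hphin n.
  rewrite fnorm normrZ ger0_norm // in hn.
  have hD : n%:R * `|u| + phin n (f x) <= `|f (n%:R *: u) + f x|.
    by rewrite -hn -linearD; exact: (hphin n).1.
  have hB : n%:R * `|u| - phin n (f x) <= `|f (n%:R *: u) - f x|.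
    by rewrite -hn -linearB; exact: (hphin n).1.
  rewrite (addrC x) in ht1; rewrite (addrC (- x)) in ht2.
  (* The norms in [hD] and [hB] are those of [n u + x] and [n u - x] in some order, at most
     [n |u| + e] plus or minus [xstar x]. The order decides the sign. All four memberships are
     needed to recover the matching with multiplicity. *)
  have : `|xstar x - phin n (f x)| <= e \/ `|xstar x + phin n (f x)| <= e.
    have P1 : [set `|n%:R *: u + x|; `|n%:R *: u - x|] `|f (n%:R *: u) + f x|.
      by rewrite -f_phase; left.
    have P2 : [set `|n%:R *: u + x|; `|n%:R *: u - x|] `|f (n%:R *: u) - f x|.
      by rewrite -f_phase; right.
    have P3 : [set `|f (n%:R *: u) + f x|; `|f (n%:R *: u) - f x|] `|n%:R *: u + x|.
      by rewrite f_phase; left.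
    have P4 : [set `|f (n%:R *: u) + f x|; `|f (n%:R *: u) - f x|] `|n%:R *: u - x|.
      by rewrite f_phase; right.
    rewrite !ler_norml.
    case: P1 => /= e1; case: P2 => /= e2; case: P3 => /= e3; case: P4 => /= e4;
      first [left; apply/andP; split; lra|right; apply/andP; split; lra].
  case=> h.
    exact: le_trans (ler_dist_dist _ _) h.
  rewrite -(normrN (phin n (f x))); apply: le_trans (ler_dist_dist _ _) _.
  by rewrite opprK.
exists phi; split.
- exact: linear_le_norm_dual.
- apply: (dual_norm_eq1 (x := f u)) => //.
    by rewrite -normr_eq0 fnorm normr_eq0.
  by rewrite phif fnorm xuu normr_id.
- move=> x; have /eqP := phif x; rewrite eqr_norm2 => /orP[]/eqP->; first by left.
  by rewrite opprK; right.
Unshelve. all: by end_near. Qed.
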